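(* Let $k$ be a positive integer, $p$ a prime, $n=p^k$ and $n_0=p^{k+1}$. Then an integral basis of the pure fields $\mathbb{Q}(\sqrt[n]{m})$, where $m\neq\pm1$ ranges over square-free integers, is repeating periodically modulo $n_0$.
   Context: For an integer $n\geq2$ and a square-free integer $m\neq\pm1$, let $\alpha_m$ be a root of $X^n-m$ and $K_m=\mathbb{Q}(\alpha_m)$ (a field of degree $n$). An integral basis of the fields $K_m$ is said to be repeating periodically modulo $n_0$ if for each residue class $r$ modulo $n_0$ there exist polynomials $h^{(r)}_0(X),\ldots,h^{(r)}_{n-1}(X)\in\mathbb{Q}[X]$ such that whenever $m$ is square-free, $m\neq\pm1$, and $m\equiv r \pmod{n_0}$, the tuple $(h^{(r)}_0(\alpha_m),\ldots,h^{(r)}_{n-1}(\alpha_m))$ is an integral basis (a $\mathbb{Z}$-basis of the ring of integers) of $K_m$. *)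

(* Defs.v *)
From HB Require Import structures.
From mathcomp Require Import all_boot all_order all_algebra all_field.
Set Implicit Arguments. Unset Strict Implicit. Unset Printing Implicit Defensive.
Import Order.TTheory GRing.Theory Num.Theory.
Local Open Scope ring_scope.

(* square-free integer: no square d^2 with d > 1 divides m (so m <> 0) *)
Definition squarefree_int (m : int) : Prop :=
  forall d : nat, (d * d %| `|m|)%N -> d = 1%N.

Definition ratpoly_eval (q : {poly rat}) (a : algC) : algC :=
  (map_poly (@ratr algC) q).[a].

(* membership in the number field Q(a) = Q[a] (a algebraic) *)
Definition in_Qadj (a x : algC) : Prop := exists q : {poly rat}, x = ratpoly_eval q a.

Definition integral_basis (n : nat) (a : algC) (b : 'I_n -> algC) : Prop :=
  [/\ forall i, in_Qadj a (b i) /\ b i \in Aint,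
      forall x, in_Qadj a x -> x \in Aint ->
        exists c : 'I_n -> int, x = \sum_(i < n) (c i)%:~R * b i
    & forall c : 'I_n -> int, \sum_(i < n) (c i)%:~R * b i = 0 ->
        forall i, c i = 0].

(* Main.v *)
(* Put n = p^k and let a^n = m with m congruent to r mod p^(k+1); then
   c = m - r^n has p-adic valuation D + 1, with D = 0 if p | m, unless D = k,
   where D <= k depends only on r. For d <= D let Y = a^(p^(k-d)) and
   t = r^(p^(k-d)). The element
     theta_d = (Y^(p^d) - t^(p^d)) / (p^d (Y - t)),
   which satisfies p^d (Y - t) theta_d = c, is integral, and the lattice L
   spanned over Z[a] by theta_0, ..., theta_D has as Z-basis suitable a^i theta_d,
   one in each degree < n; these are rational polynomials in a depending only
   on r.
   The lattice L contains every algebraic integer x of Q(a) because l x in L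
   implies x in L for every prime l. For l <> p this is read off the traces of
   x a^(-i), and for l = p | m it is the Eisenstein argument. For l = p not
   dividing m, put pi = a - r: as pi^n is in p Z[a], it suffices to treat pi
   instead of p. If pi x = sum_d e_d theta_d + pi w with w in L, then the sum is
   p-adically topologically nilpotent, so its trace from Q(a^(p^(k-D))), which is a unit
   times e_D modulo p, is divisible by p; hence p | e_D, and recursively all e_d
   are divisible by p. Since p theta_d is in Z p + pi L, one may assume that
   pi x is an integer multiple of p, and then p^D (Y - t) theta_D = c
   concludes. *)
Require Import Defs.
From HB Require Import structures.
From mathcomp Require Import all_boot all_order all_algebra all_field.
From mathcomp Require Import ring zify.
Import Order.TTheory GRing.Theory Num.Theory.
Local Open Scope ring_scope.

Set Implicit Arguments.
Unset Strict Implicit.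
Unset Printing Implicit Defensive.

(** * Divisibility, and evaluation of rational and integer polynomials *)

Definition intpoly_eval (w : {poly int}) (a : algC) : algC :=
  (map_poly intr w).[a].

Lemma Aint_divn_dvdn (d : nat) (u : int) :
  (0 < d)%N -> u%:~R / d%:R \in Aint -> (d %| `|u|)%N.
Proof.
move=> d_gt0 Au.
have nz_d : d%:R != 0 :> algC by rewrite pnatr_eq0 -lt0n.
have /intrP[e De] : (u%:~R / d%:R : algC) \in Num.int.
  by apply: Cint_rat_Aint => //; rewrite rpred_div ?rpred_int ?rpred_nat.
have : u%:~R = (e * d%:Z)%:~R :> algC.
  by rewrite intrM -De divfK.
by move/intr_inj->; rewrite abszM dvdn_mull.
Qed.

(** As [q] divides [m] at most once, [m ^ i] supplies at most i < N factors [q], so one must come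
    from [e]. This is applied to the N-th powers of elements e a^i / q. *)
Lemma prime_dvdn_expM (q N i e m : nat) :
  prime q -> ~~ (q * q %| m)%N -> (i < N)%N ->
  (q ^ N %| e ^ N * m ^ i)%N -> (q %| e)%N.
Proof.
move=> pr_q q2m lt_iN; apply: contraTT => qe.
have m_gt0 : (0 < m)%N by case: m q2m => [|//]; rewrite dvdn0.
rewrite Gauss_dvdr; last by rewrite coprimeXl ?coprimeXr ?prime_coprime.
rewrite pfactor_dvdn ?expn_gt0 ?m_gt0 // lognX -ltnNge.
apply: leq_ltn_trans lt_iN; rewrite -[leqRHS]muln1 leq_mul2l orbC -ltnS.
by rewrite ltnNge -pfactor_dvdn // expnS expn1 q2m.
Qed.

Lemma ratpoly_evalD f g a :
  ratpoly_eval (f + g) a = ratpoly_eval f a + ratpoly_eval g a.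
Proof. by rewrite /ratpoly_eval rmorphD hornerD. Qed.

Lemma ratpoly_evalM f g a :
  ratpoly_eval (f * g) a = ratpoly_eval f a * ratpoly_eval g a.
Proof. by rewrite /ratpoly_eval rmorphM hornerM. Qed.

Lemma ratpoly_evalX f a i : ratpoly_eval (f ^+ i) a = ratpoly_eval f a ^+ i.
Proof. by rewrite /ratpoly_eval rmorphXn horner_exp. Qed.

Lemma ratpoly_evalZ c f a :
  ratpoly_eval (c *: f) a = ratr c * ratpoly_eval f a.
Proof. by rewrite /ratpoly_eval map_polyZ hornerZ. Qed.

Lemma ratpoly_evalC c a : ratpoly_eval c%:P a = ratr c.
Proof. by rewrite /ratpoly_eval map_polyC hornerC. Qed.

Lemma ratpoly_eval_Xn a i : ratpoly_eval 'X^i a = a ^+ i.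
Proof. by rewrite /ratpoly_eval map_polyXn hornerXn. Qed.

Lemma ratpoly_eval_sum I (s : seq I) (P : pred I) (F : I -> {poly rat}) a :
  ratpoly_eval (\sum_(i <- s | P i) F i) a =
  \sum_(i <- s | P i) ratpoly_eval (F i) a.
Proof. by rewrite /ratpoly_eval rmorph_sum horner_sum. Qed.

Lemma ratpoly_eval_wide (N : nat) (g : {poly rat}) (a : algC) :
  (size g <= N)%N -> ratpoly_eval g a = \sum_(i < N) ratr g`_i * a ^+ i.
Proof.
move=> szg; rewrite /ratpoly_eval (@horner_coef_wide _ N) ?size_map_poly //.
by apply: eq_bigr => i _; rewrite coef_map.
Qed.

Lemma ratpoly_eval_int (w : {poly int}) a :
  ratpoly_eval (map_poly intr w) a = intpoly_eval w a.
Proof.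
rewrite /ratpoly_eval /intpoly_eval -map_poly_comp.
by congr horner; apply: eq_map_poly => c; rewrite /= ratr_int.
Qed.

Lemma intpoly_evalZ e w a :
  intpoly_eval (e *: w) a = e%:~R * intpoly_eval w a.
Proof. by rewrite /intpoly_eval map_polyZ hornerZ. Qed.

Lemma intpoly_eval_sum I (s : seq I) (P : pred I) (F : I -> {poly int}) a :
  intpoly_eval (\sum_(i <- s | P i) F i) a =
  \sum_(i <- s | P i) intpoly_eval (F i) a.
Proof. by rewrite /intpoly_eval rmorph_sum horner_sum. Qed.

Lemma Aint_root (N : nat) (m : int) (a : algC) :
  (0 < N)%N -> a ^+ N = m%:~R -> a \in Aint.
Proof.
move=> N_gt0 aN; apply: (@root_monic_Aint ('X^N - (m%:~R)%:P)).
- by rewrite /root !hornerE aN subrr.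
- exact: monicXnsubC.
apply/polyOverP => i; rewrite coefB coefXn coefC.
by rewrite rpredB ?rpred_nat //; case: eqP => _; rewrite ?rpred_int ?rpred0.
Qed.

(** * Conjugates and traces for a root of X^N - m *)

Section PureRoot.

Variables (N q : nat) (m : int) (a : algC).
Hypotheses (N_gt0 : (0 < N)%N) (pr_q : prime q).
Hypotheses (qm : (q %| `|m|)%N) (q2m : ~~ (q * q %| `|m|)%N).
Hypothesis aN : a ^+ N = m%:~R.

(** Eisenstein's criterion at [q], which divides [m] exactly once. *)
Lemma pure_poly_irreducible :
  irreducible_poly ('X^N - (m%:~R)%:P : {poly rat}).
Proof.
have -> : 'X^N - (m%:~R)%:P = map_poly intr ('X^N - m%:P) :> {poly rat}.
  by rewrite rmorphB /= map_polyXn map_polyC.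
apply/irreducible_rat_int; apply: (@eisenstein_crit q) => //.
- by rewrite size_XnsubC // eqSS -lt0n.
- by rewrite (monicP (monicXnsubC _ N_gt0)) dvdzE /= dvdn1 neq_ltn prime_gt1 ?orbT.
- rewrite coefB coefXn coefC eqxx eq_sym gtn_eqF // sub0r dvdzE abszN /=.
  exact: q2m.
move=> i; rewrite size_XnsubC //= => ltiN.
rewrite coefB coefXn coefC ltn_eqF // sub0r dvdzE abszN.
by case: eqP => // _; rewrite dvdn0.
Qed.

Lemma ratpoly_eval_eq0 (g : {poly rat}) :
  ratpoly_eval g a = 0 -> 'X^N - (m%:~R)%:P %| g.
Proof.
have [P [_ monP dvP]] := minCpolyP a.
have fa : root (map_poly ratr ('X^N - (m%:~R)%:P)) a.
  by rewrite rmorphB /= map_polyXn map_polyC /= ratr_int /root !hornerE aN subrr.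
have P1 : size P != 1%N.
  apply/negP => /size_poly1P[c nzc Dc].
  have : root (map_poly ratr P) a by rewrite dvP.
  by rewrite Dc map_polyC /root hornerC fmorph_eq0 (negPf nzc).
have [_ irr] := pure_poly_irreducible.
move=> ga; have : root (map_poly ratr g) a by apply/eqP.
rewrite dvP; apply: dvdp_trans.
by have := irr P P1; rewrite -dvP => /(_ fa) /andP[].
Qed.

(** If P is the minimal polynomial of g(a), then X^N - m divides the composite P(g(X)), so P also
    vanishes at g(z a). *)
Lemma conj_Aint (g : {poly rat}) (z : algC) :
  z ^+ N = 1 -> ratpoly_eval g a \in Aint -> ratpoly_eval g (z * a) \in Aint.
Proof.
move=> zN Ag; have [P [DP monP _]] := minCpolyP (ratpoly_eval g a).
have evP b : ratpoly_eval (P \Po g) b = (minCpoly (ratpoly_eval g a)).[ratpoly_eval g b].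
  by rewrite DP /ratpoly_eval map_comp_poly horner_comp.
have /ratpoly_eval_eq0/dvdpP[h Dh] : ratpoly_eval (P \Po g) a = 0.
  by rewrite evP; apply/rootP/root_minCpoly.
apply: (@root_monic_Aint (minCpoly (ratpoly_eval g a))) => //.
  rewrite /root -evP Dh ratpoly_evalM [X in _ * X](_ : _ = 0) ?mulr0 //.
  rewrite ratpoly_evalD ratpoly_eval_Xn exprMn zN mul1r aN.
  by rewrite -polyCN ratpoly_evalC rmorphN /= ratr_int subrr.
exact: minCpoly_monic.
Qed.

Lemma sum_unity_root_exp (z : algC) (e : nat) :
  N.-primitive_root z ->
  \sum_(j < N) (z ^+ j) ^+ e = if (N %| e)%N then N%:R else 0.
Proof.
move=> prz; case: ifP => Ne.
  rewrite (eq_bigr (fun=> 1)) ?sumr_const ?card_ord // => j _.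
  by rewrite exprAC; move: Ne; rewrite (prim_order_dvd prz) => /eqP->; rewrite expr1n.
have z1 : z ^+ e != 1 by rewrite -(prim_order_dvd prz) Ne.
apply: (mulfI (x := z ^+ e - 1)); first by rewrite subr_eq0.
rewrite mulr0 (eq_bigr (fun j : 'I_N => (z ^+ e) ^+ j)) => [|j _].
  by rewrite -subrX1 exprAC (prim_expr_order prz) expr1n subrr.
by rewrite exprAC.
Qed.

(** This element is a^i times the trace of g(a) a^(-i): summing the conjugates g(z^j a) with weights
    z^(-ij) isolates the monomial of degree [i], and every summand is integral. *)
Lemma coef_Aint (g : {poly rat}) (i : 'I_N) :
  (size g <= N)%N -> ratpoly_eval g a \in Aint ->
  N%:R * (ratr g`_i * a ^+ i) \in Aint.
Proof.
move=> szg Ag; have [z prz] := C_prim_root_exists N_gt0.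
have Az : z \in Aint := Aint_prim_root prz.
have -> : N%:R * (ratr g`_i * a ^+ i) =
    \sum_(j < N) (z ^+ j) ^+ (N - i) * ratpoly_eval g (z ^+ j * a).
  have collect (w c : algC) (l : nat) :
      w ^+ (N - i) * (c * (w * a) ^+ l) = w ^+ (N - i + l) * (c * a ^+ l).
    by rewrite exprMn exprD; ring.
  under eq_bigr => j _ do rewrite (ratpoly_eval_wide _ szg) mulr_sumr.
  rewrite exchange_big (bigD1 i) //= [X in _ + X]big1 ?addr0 => [|l neq_li].
    under eq_bigr => j _ do rewrite collect.
    by rewrite -mulr_suml sum_unity_root_exp // subnK ?dvdnn // ltnW.
  under eq_bigr => j _ do rewrite collect.
  rewrite -mulr_suml sum_unity_root_exp // ifN ?mul0r //.
  apply: contra neq_li => /dvdnP[c Dc]; apply/eqP/val_inj => /=.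
  move: (ltn_ord i) (ltn_ord l) => lti ltl.
  (* N - i + l lies strictly between 0 and 2N, so it is a multiple of N only if it equals N, that
     is, l = i. *)
  have lt1 : (c * N < 2 * N)%N by rewrite -Dc; lia.
  have lt0 : (0 * N < c * N)%N by rewrite -Dc; lia.
  rewrite !ltn_mul2r in lt1 lt0; have c1 : c = 1%N by lia.
  by rewrite c1 in Dc; lia.
rewrite rpred_sum // => j _; rewrite rpredM ?rpredX // conj_Aint //.
by rewrite exprAC (prim_expr_order prz) expr1n.
Qed.

End PureRoot.

(** * Congruence modulo p in the ring of all algebraic integers, and Frobenius *)

Definition congA (p : nat) (x y : algC) : bool := (x - y) / p%:R \in Aint.

Section Congruence.

Variable p : nat.
Hypothesis pr_p : prime p.

Let nz_p : p%:R != 0 :> algC.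
Proof. by rewrite pnatr_eq0 -lt0n prime_gt0. Qed.

Lemma congA_refl x : congA p x x.
Proof. by rewrite /congA subrr mul0r Aint0. Qed.

Lemma congA_sym x y : congA p x y -> congA p y x.
Proof. by rewrite /congA -opprB mulNr rpredN. Qed.

Lemma congA_trans y x z : congA p x y -> congA p y z -> congA p x z.
Proof.
rewrite /congA => Axy Ayz; rewrite (_ : x - z = (x - y) + (y - z)); last by ring.
by rewrite mulrDl rpredD.
Qed.

Lemma congA_add x1 x2 y1 y2 :
  congA p x1 x2 -> congA p y1 y2 -> congA p (x1 + y1) (x2 + y2).
Proof.
rewrite /congA => Ax Ay.
rewrite (_ : _ - _ = (x1 - x2) + (y1 - y2)); last by ring.
by rewrite mulrDl rpredD.
Qed.

Lemma congA_mul0 x y : x \in Aint -> congA p y 0 -> congA p (x * y) 0.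
Proof. by rewrite /congA !subr0 => Ax Ay; rewrite -mulrA rpredM. Qed.

Lemma congA_pmul x : x \in Aint -> congA p (p%:R * x) 0.
Proof. by rewrite /congA subr0 mulrAC divff ?mul1r. Qed.

Lemma congA_dvd (u : int) : (p %| `|u|)%N -> congA p u%:~R 0.
Proof.
case/dvdnP => e De.
have -> : u = p%:Z * (sgz u * e%:Z) by rewrite [u in LHS]intEsg De PoszM; ring.
by rewrite intrM congA_pmul ?Aint_int.
Qed.

Lemma congA_dvdn (u : int) : congA p u%:~R 0 -> (p %| `|u|)%N.
Proof. by rewrite /congA subr0; apply: Aint_divn_dvdn; rewrite prime_gt0. Qed.

Lemma congA_exp x y e :
  x \in Aint -> y \in Aint -> congA p x y -> congA p (x ^+ e) (y ^+ e).
Proof.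
move=> Ax Ay; rewrite /congA => Axy; rewrite subrXX mulrAC rpredM // rpred_sum //.
by move=> i _; rewrite rpredM ?rpredX.
Qed.

(** With P = p^f one has i 'C(P, i) = P 'C(P - 1, i - 1); if [p] did not divide 'C(P, i), then P
    would divide [i]. *)
Lemma prime_dvd_bin_expn f i : (0 < i < p ^ f)%N -> (p %| 'C(p ^ f, i))%N.
Proof.
case/andP=> i_gt0 ltiP; apply: contraLR ltiP => pC; rewrite -leqNgt dvdn_leq //.
have co : coprime (p ^ f) 'C(p ^ f, i) by rewrite coprimeXl // prime_coprime.
by rewrite -(Gauss_dvdl _ co) -[i]prednK // -mul_bin_diag dvdn_mulr.
Qed.

Lemma congA_frobenius_add f x y : x \in Aint -> y \in Aint ->
  congA p ((x + y) ^+ (p ^ f)) (x ^+ (p ^ f) + y ^+ (p ^ f)).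
Proof.
move=> Ax Ay; have := prime_dvd_bin_expn (f := f).
have : (0 < p ^ f)%N by rewrite expn_gt0 prime_gt0.
move: (p ^ f)%N => [//|P] _ dvd_bin; rewrite /congA exprDn.
rewrite big_ord_recl big_ord_recr /= subn0 subnn bin0 binn !expr0 mulr1 mul1r !mulr1n.
rewrite [X in X / _](_ : _ = \sum_(i < P)
   x ^+ (P.+1 - bump 0 i) * y ^+ bump 0 i *+ 'C(P.+1, bump 0 i)); last by ring.
rewrite mulr_suml rpred_sum // => i _.
rewrite -[_ *+ _]mulr_natr -!mulrA; do 2![apply: rpredM; first exact: rpredX].
have /dvdnP[e ->] : (p %| 'C(P.+1, bump 0 i))%N.
  by rewrite dvd_bin //= /bump /= add1n ltnS ltn_ord.
by rewrite natrM mulfK // rpred_nat.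
Qed.

Lemma congA_frobenius_sum f I (s : seq I) (F : I -> algC) :
  (forall i, F i \in Aint) ->
  congA p ((\sum_(i <- s) F i) ^+ (p ^ f)) (\sum_(i <- s) F i ^+ (p ^ f)).
Proof.
move=> AF; elim: s => [|i s IHs].
  by rewrite !big_nil expr0n expn_eq0 -leqn0 leqNgt prime_gt0 //= congA_refl.
rewrite !big_cons; apply: congA_trans (congA_frobenius_add _ _ _) _ => //.
  by rewrite rpred_sum.
by rewrite congA_add ?congA_refl.
Qed.

End Congruence.

(** * Divisibility of coefficients, by traces and by Eisenstein's argument *)

Section PureRootTrace.

Variables (N q : nat) (m : int) (a : algC).
Hypotheses (N_gt0 : (0 < N)%N) (pr_q : prime q).
Hypotheses (qm : (q %| `|m|)%N) (q2m : ~~ (q * q %| `|m|)%N).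
Hypothesis aN : a ^+ N = m%:~R.

Let Aa : a \in Aint := Aint_root N_gt0 aN.

(* N g_0 is the trace of g(a) to Q. *)
Lemma trace_dvd_of_nilpotent (p f : nat) (g : {poly rat}) (u : int) :
  prime p -> (size g <= N)%N -> ratpoly_eval g a \in Aint ->
  congA p (ratpoly_eval g a ^+ (p ^ f)) 0 ->
  N%:R * ratr g`_0 = u%:~R :> algC -> (p %| `|u|)%N.
Proof.
move=> pr_p szg Ag nilg Du; have [z prz] := C_prim_root_exists N_gt0.
have zjN (j : 'I_N) : (z ^+ j) ^+ N = 1.
  by rewrite exprAC (prim_expr_order prz) expr1n.
have Tr : u%:~R = \sum_(j < N) ratpoly_eval g (z ^+ j * a).
  under eq_bigr => j _ do rewrite (ratpoly_eval_wide _ szg).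
  rewrite exchange_big (bigD1 (Ordinal N_gt0)) //= [X in _ + X]big1 => [|l nz_l].
    under eq_bigr => j _ do rewrite expr0 mulr1.
    by rewrite addr0 sumr_const card_ord -mulr_natl Du.
  under eq_bigr => j _ do rewrite exprMn mulrCA.
  rewrite -mulr_suml (sum_unity_root_exp _ prz) ifN ?mul0r // gtnNdvd //.
  by rewrite lt0n; apply: contra nz_l => /eqP l0; apply/eqP/val_inj.
(* By Frobenius the p^f-th power of the trace is congruent to the sum of the p^f-th powers of the
   conjugates. Each of these is a multiple of [p], since the quotient by [p] is conjugate to the
   integral quotient for g(a). *)
suff : congA p (u ^+ (p ^ f))%:~R 0.
  by move/(congA_dvdn pr_p); rewrite abszX Euclid_dvdX // => /andP[].
rewrite rmorphXn /= Tr; apply: congA_trans (congA_frobenius_sum pr_p _ _ _) _.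
  by move=> j; apply: (conj_Aint N_gt0 pr_q qm q2m aN).
rewrite /congA subr0 mulr_suml rpred_sum // => j _.
have evp b : ratpoly_eval g b ^+ (p ^ f) / p%:R
    = ratpoly_eval (p%:R^-1 *: g ^+ (p ^ f)) b.
  by rewrite ratpoly_evalZ ratpoly_evalX fmorphV /= ratr_nat mulrC.
rewrite evp; apply: (conj_Aint N_gt0 pr_q qm q2m aN) => //.
by rewrite -evp; rewrite /congA subr0 in nilg.
Qed.

(** Strong induction on [i]. After multiplication by a^(N-1-i), the terms below [i] vanish modulo
    [q] by induction and those above because a^N = m; so [q] divides w_i a^(N-1). Taking N-th powers
    gives q^N | w_i^N m^(N-1). *)
Lemma eisenstein_coef_dvd (w : {poly int}) (i : nat) :
  (size w <= N)%N -> congA q (intpoly_eval w a) 0 -> (q %| `|(w`_i)%R|)%N.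
Proof.
move=> szw; have [Ni _|] := leqP N i.
  by rewrite nth_default ?(leq_trans szw) // dvdn0.
elim/ltn_ind: i => i IHi ltiN wa0.
have am j : (N <= j)%N -> congA q (a ^+ j) 0.
  move=> leNj; rewrite -(subnK leNj) exprD aN congA_mul0 ?rpredX //.
  exact: congA_dvd.
have : congA q ((w`_i)%:~R * a ^+ N.-1) 0.
  have wE : a ^+ (N.-1 - i) * intpoly_eval w a =
      (w`_i)%:~R * a ^+ N.-1 +
      \sum_(j < N | j != Ordinal ltiN) (w`_j)%:~R * a ^+ (N.-1 - i + j).
    rewrite /intpoly_eval (@horner_coef_wide _ N) ?(leq_trans (size_poly _ _)) //.
    rewrite (bigD1 (Ordinal ltiN)) //= mulrDr mulr_sumr coef_map; congr (_ + _).
      by rewrite mulrCA -exprD subnK // -ltnS prednK.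
    by apply: eq_bigr => j _; rewrite coef_map /= mulrCA -exprD.
  have S0 : congA q (\sum_(j < N | j != Ordinal ltiN)
                      (w`_j)%:~R * a ^+ (N.-1 - i + j)) 0.
    rewrite /congA subr0 mulr_suml rpred_sum // => j neq_ji.
    rewrite -[X in X / _]subr0 -/(congA _ _ _).
    have [ltji|leij] := ltnP j i.
      rewrite mulrC congA_mul0 ?rpredX ?congA_dvd // IHi //.
    rewrite congA_mul0 ?rpred_int // am //.
    have : (val j != i) by apply: contra neq_ji => /eqP ji; apply/eqP/val_inj.
    have ltjN := ltn_ord j; move: leij; clear - ltjN ltiN N_gt0 => /=; lia.
  have := congA_mul0 (rpredX (N.-1 - i) Aa) wa0; rewrite wE.
  move: S0; rewrite /congA !subr0 => S0.
  by rewrite mulrDl => /rpredB/(_ S0); rewrite addrK.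
have aNp : (a ^+ N.-1) ^+ N = (m ^+ N.-1)%:~R by rewrite exprAC aN rmorphXn.
rewrite /congA subr0 => /(rpredX N); rewrite expr_div_n exprMn aNp -natrX.
rewrite -[(_)%:~R ^+ N]rmorphXn -rmorphM /= => /Aint_divn_dvdn.
rewrite expn_gt0 prime_gt0 // abszM !abszX => /(_ isT).
by apply: prime_dvdn_expM; rewrite // prednK.
Qed.

Lemma ratpoly_eval_inj0 (g : {poly rat}) :
  (size g <= N)%N -> ratpoly_eval g a = 0 -> g = 0.
Proof.
move=> szg /(ratpoly_eval_eq0 N_gt0 pr_q qm q2m aN) dvg; apply/eqP.
apply: contraTT dvg => nz_g; rewrite gtNdvdp // size_XnsubC //.
Qed.

(** By [coef_Aint], N w_i a^i / q' is integral. Its N-th power is rational, hence an integer, and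
    [prime_dvdn_expM] applies to N w_i. *)
Lemma coef_dvd_of_Aint (q' : nat) (w : {poly int}) (i : nat) (y : algC) :
  prime q' -> ~~ (q' * q' %| `|m|)%N -> ~~ (q' %| N)%N -> (size w <= N)%N ->
  y \in Aint -> q'%:R * y = intpoly_eval w a -> (q' %| `|(w`_i)%R|)%N.
Proof.
move=> pr_q' q'2m q'N szw Ay Dy; have [Ni|ltiN] := leqP N i.
  by rewrite nth_default ?(leq_trans szw) // dvdn0.
have nz_q' : q'%:R != 0 :> algC by rewrite pnatr_eq0 -lt0n prime_gt0.
pose g : {poly rat} := q'%:R^-1 *: map_poly intr w.
have szg : (size g <= N)%N.
  by rewrite (leq_trans (size_scale_leq _ _)) // (leq_trans (size_poly _ _)).
have Eg : ratpoly_eval g a = y.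
  by rewrite ratpoly_evalZ fmorphV /= ratr_nat ratpoly_eval_int -Dy mulKf.
have := coef_Aint N_gt0 pr_q qm q2m aN (Ordinal ltiN) szg.
rewrite Eg => /(_ Ay) /= /(rpredX N).
rewrite coefZ coef_map rmorphM fmorphV /= ratr_nat ratr_int.
have -> : (N%:R * (q'%:R^-1 * (w`_i)%:~R * a ^+ i)) ^+ N
    = ((N%:Z * w`_i) ^+ N * m ^+ i)%:~R / (q' ^ N)%:R :> algC.
  rewrite rmorphM !rmorphXn /= -aN rmorphM /= -pmulrn !exprMn exprAC.
  by rewrite exprVn; ring.
move/Aint_divn_dvdn; rewrite expn_gt0 prime_gt0 // => /(_ isT).
rewrite abszM !abszX abszM => /prime_dvdn_expM.
by rewrite Euclid_dvdM // (negPf q'N) orFb; apply.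
Qed.

End PureRootTrace.

(** * Integrality of a cofactor quotient *)

(** Since p^d divides i 'C(p^d, i) and v_p(i) <= i - 1, the valuation on the right is at least d -
    (i - 1) + (d + 1)(i - 1) = d i. *)
Lemma expn_dvd_binM (p d i : nat) (c : nat) :
  prime p -> (0 < i <= p ^ d)%N -> (p ^ d.+1 %| c)%N ->
  ((p ^ d) ^ i %| 'C(p ^ d, i) * c ^ i.-1)%N.
Proof.
move=> pr_p /andP[i_gt0 leiP] pc; have p_gt0 := prime_gt0 pr_p.
apply: (@dvdn_trans ('C(p ^ d, i) * (p ^ d.+1) ^ i.-1)); last first.
  by rewrite dvdn_mul ?dvdn_exp2r.
have C_gt0 : (0 < 'C(p ^ d, i))%N by rewrite bin_gt0.
rewrite -!expnM pfactor_dvdn ?muln_gt0 ?C_gt0 ?expn_gt0 ?p_gt0 //.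
rewrite lognM ?expn_gt0 ?p_gt0 // pfactorK //.
have : (d <= logn p i + logn p 'C(p ^ d, i))%N.
  rewrite -lognM // -pfactor_dvdn ?muln_gt0 ?i_gt0 //.
  have := mul_bin_diag (p ^ d) i.-1; rewrite prednK // => <-.
  exact: dvdn_mulr.
have := ltn_logl p i_gt0.
by case: i i_gt0 {leiP C_gt0} => // i _ /=; nia.
Qed.

(* With z = Y - t, expanding (z + t)^P - t^P = c and using P z th = c gives
   th^P = sum_(0 < i <= P) 'C(P, i) t^(P-i) c^(i-1) / P^i th^(P-i). *)
Lemma cofactor_quotient_Aint (p d : nat) (t c : int) (z th : algC) :
  prime p -> (p ^ d.+1 %| `|c|)%N -> c != 0 ->
  (z + t%:~R) ^+ (p ^ d) - t%:~R ^+ (p ^ d) = c%:~R ->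
  (p ^ d)%:R * z * th = c%:~R -> th \in Aint.
Proof.
move=> pr_p pc nz_c; have P_gt0 : (0 < p ^ d)%N by rewrite expn_gt0 prime_gt0.
have dvdP := fun i hi => @expn_dvd_binM p d i `|c| pr_p hi pc.
move: P_gt0 dvdP; set P := (p ^ d)%N => P_gt0 dvdP Dc Dth.
have nz_P : P%:R != 0 :> algC by rewrite pnatr_eq0 -lt0n.
have nzc : c%:~R != 0 :> algC by rewrite intr_eq0.
pose e i : int := (('C(P, i)%:Z * c ^+ i.-1) %/ (P ^ i)%:Z)%Z.
have De i : (0 < i <= P)%N ->
    'C(P, i)%:R * c%:~R ^+ i = c%:~R * ((e i)%:~R * P%:R ^+ i) :> algC.
  move=> hi; have : 'C(P, i)%:Z * c ^+ i.-1 = e i * (P ^ i)%:Z.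
    by rewrite /e divzK // dvdzE abszM abszX; apply: dvdP.
  move/(congr1 (fun u : int => c%:~R * u%:~R : algC)).
  rewrite !rmorphM /= rmorphXn /= -!pmulrn natrX => <-.
  case/andP: hi => i_gt0 _; rewrite mulrCA; congr (_ * _).
  by rewrite -[in LHS](prednK i_gt0) exprS.
(* The right-hand side of the equation for [th], indexed by the degree j = P - i; its degree is
   below P, so 'X^P - g is monic. *)
pose g : {poly algC} := \poly_(j < P) ((e (P - j)%N * t ^+ j)%:~R).
apply: (@root_monic_Aint ('X^P - g)).
(* Multiplied by [c], the equation compares the binomial expansion of ((z + t)^P - t^P) th^P with c
   g(th) term by term. *)
- rewrite /root !hornerE subr_eq0; apply/eqP; apply: (mulfI nzc).
  rewrite horner_poly -[X in X * _]Dc exprDn big_ord_recr /= subnn binn.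
  rewrite expr0 mul1r mulr1n addrK mulr_suml mulr_sumr; apply: eq_bigr => j _.
  have ltjP := ltn_ord j.
  have hj : (0 < P - j <= P)%N by rewrite subn_gt0 ltjP leq_subr.
  have Ej : 'C(P, j)%:R * (z * th) ^+ (P - j) = c%:~R * (e (P - j)%N)%:~R.
    apply: (mulIf (expf_neq0 (P - j) nz_P)).
    rewrite -[RHS]mulrA -De // bin_sub 1?ltnW // -Dth.
    have -> : P%:R * z * th = z * th * P%:R by ring.
    by rewrite [in RHS]exprMn mulrA.
  rewrite rmorphM rmorphXn /= !mulrA -Ej exprMn -mulr_natl.
  have -> : th ^+ P = th ^+ (P - j) * th ^+ j by rewrite -exprD subnK // ltnW.
  by ring.
- rewrite monicE lead_coefDl ?lead_coefXn // size_polyN size_polyXn.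
  exact: (leq_trans (size_poly _ _)).
apply/polyOverP => j; rewrite coefB coefXn coef_poly.
by rewrite rpredB ?rpred_nat //; case: ifP; rewrite ?rpred_int ?rpred0.
Qed.

(** * The basis polynomials and their degrees *)

Section PeriodicBasis.

Variables (p k D : nat) (r : int).

(* (Y^(p^d) - t^(p^d)) / (Y - t) with Y = X^(p^(l-d)) and t = r^(p^(k-d)); taking
   l < k describes the same element inside the subfield Q(a^(p^(k-l))). *)
Definition cofactor_poly (l d : nat) : {poly int} :=
  \sum_(i < p ^ d)
     r ^+ (p ^ (k - d) * i) *: 'X^(p ^ (l - d) * ((p ^ d).-1 - i)).

Definition theta_poly (l d : nat) : {poly rat} :=
  (p ^ d)%:R^-1 *: map_poly intr (cofactor_poly l d).

(* The d such that the basis element of degree j is a^i theta_d. *)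
Definition depth (j : nat) : nat := minn D (k - up_log p (p ^ k - j)).

Definition basis_poly (j : nat) : {poly rat} :=
  'X^(j - (p ^ k - p ^ (k - depth j))) * theta_poly k (depth j).

Hypotheses (pr_p : prime p) (leDk : (D <= k)%N).

Let p_gt0 : (0 < p)%N := prime_gt0 pr_p.
Let p_gt1 : (1 < p)%N := prime_gt1 pr_p.
Let pX_gt0 i : (0 < p ^ i)%N. Proof. by rewrite expn_gt0 p_gt0. Qed.
Let nz_pX i : (p ^ i)%:R != 0 :> algC.
Proof. by rewrite pnatr_eq0 -lt0n. Qed.

Lemma size_cofactor_poly l d : (d <= l)%N ->
  (size (cofactor_poly l d) <= (p ^ l - p ^ (l - d)).+1)%N.
Proof.
move=> ledl; rewrite (leq_trans (size_sum _ _ _)) //; apply/bigmax_leqP => i _.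
rewrite (leq_trans (size_scale_leq _ _)) // size_polyXn ltnS.
apply: (@leq_trans (p ^ (l - d) * (p ^ d).-1)); first by rewrite leq_mul2l leq_subr orbT.
by rewrite -subn1 mulnBr muln1 -expnD subnK.
Qed.

Lemma coef0_cofactor_poly l d :
  (cofactor_poly l d)`_0 = r ^+ (p ^ (k - d) * (p ^ d).-1).
Proof.
have ltP : ((p ^ d).-1 < p ^ d)%N by rewrite prednK.
rewrite coef_sum (bigD1 (Ordinal ltP)) //= big1 ?addr0 => [|i neq_i].
  by rewrite coefZ coefXn subnn muln0 eqxx mulr1.
rewrite coefZ coefXn [0%N == _]eq_sym muln_eq0 eqn0Ngt pX_gt0 /= subn_eq0.
rewrite (_ : (_ <= i)%N = false) ?mulr0 //; apply: contraNF neq_i => lei.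
apply/eqP/val_inj => /=; have := ltn_ord i; move: lei ltP.
by set P := (p ^ d)%N; lia.
Qed.

Lemma depth_le j : (depth j <= D)%N. Proof. exact: geq_minl. Qed.

(** Equivalently, theta_d with d = [depth j] has degree at most [j], so the subtraction in
    [basis_poly] is exact. *)
Lemma depth_bound j : (j < p ^ k)%N -> (p ^ k - j <= p ^ (k - depth j))%N.
Proof.
move=> ltj; apply: leq_trans (up_logP (p ^ k - j) p_gt1) _.
have upk : (up_log p (p ^ k - j) <= k)%N by rewrite up_log_min ?leq_subr.
by rewrite leq_exp2l // /depth; lia.
Qed.

(** The degrees assigned to theta_d start at its own degree n - p^(k-d) and stop before that of
    theta_(d+1), or before n if d = D. *)
Lemma depth_eq d i : (d <= D)%N ->
  (i < p ^ (k - d) - (if d < D then p ^ (k - d.+1) else 0))%N ->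
  depth (p ^ k - p ^ (k - d) + i) = d.
Proof.
move=> ledD lti; have ledk := leq_trans ledD leDk.
have lePk : (p ^ (k - d) <= p ^ k)%N by rewrite leq_exp2l // leq_subr.
have -> : depth (p ^ k - p ^ (k - d) + i) = minn D (k - up_log p (p ^ (k - d) - i)).
  by rewrite /depth; congr (minn D (k - up_log p _)); move: lti; case: ifP; lia.
have up : (up_log p (p ^ (k - d) - i) <= k - d)%N by rewrite up_log_min ?leq_subr.
have [ltdD|] := ltnP d D; last by move=> leDd; lia.
rewrite ltdD in lti; have ltdk := leq_trans ltdD leDk.
have Ek : (k - d = (k - d.+1).+1)%N by lia.
have -> : up_log p (p ^ (k - d) - i) = (k - d)%N; last by lia.
rewrite [in RHS]Ek; apply: up_log_eq => //; rewrite -Ek leq_subr andbT.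
by move: lti; lia.
Qed.

Lemma size_basis_poly j : (j < p ^ k)%N -> size (basis_poly j) = j.+1.
Proof.
move=> ltj; set d := depth j.
have ledk : (d <= k)%N := leq_trans (depth_le j) leDk.
have lePn : (p ^ (k - d) <= p ^ k)%N by rewrite leq_exp2l // leq_subr.
have bd := depth_bound ltj; rewrite -/d in bd.
have top : (cofactor_poly k d)`_(p ^ k - p ^ (k - d)) = 1.
  rewrite coef_sum (bigD1 (Ordinal (pX_gt0 d))) //= big1 ?addr0 => [|i nz_i].
    rewrite coefZ coefXn muln0 expr0 mul1r subn0 -subn1 mulnBr muln1 -expnD.
    by rewrite subnK ?eqxx.
  rewrite coefZ coefXn (_ : (_ == _) = false) ?mulr0 //; apply: contraNF nz_i.
  have -> : (p ^ k - p ^ (k - d) = p ^ (k - d) * (p ^ d).-1)%N.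
    by rewrite -subn1 mulnBr muln1 -expnD subnK.
  rewrite eqn_pmul2l // => /eqP E; apply/eqP/val_inj => /=.
  by have := ltn_ord i; move: E (pX_gt0 d); set P := (p ^ d)%N; lia.
have szc : size (cofactor_poly k d) = (p ^ k - p ^ (k - d)).+1.
  apply/eqP; rewrite eqn_leq size_cofactor_poly //= ltnNge.
  by apply/negP => /(nth_default 0); rewrite top.
have szQ : size (theta_poly k d) = (p ^ k - p ^ (k - d)).+1.
  rewrite size_scale; last by rewrite invr_eq0 pnatr_eq0 -lt0n.
  by rewrite size_map_inj_poly ?szc //; apply: intr_inj.
rewrite /basis_poly -/d mulrC size_mulXn ?szQ -?size_poly_eq0 ?szQ //.
by move: bd lePn ltj; lia.
Qed.

(** * The elements theta_d and the relations between them *)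

Variables (m : int) (a : algC).

Let n := (p ^ k)%N.
Let c : int := m - r ^+ n.

Hypotheses (nz_c : c != 0) (an : a ^+ n = m%:~R).
Hypothesis pDc : (p ^ D.+1 %| `|c|)%N.

Let Y d := a ^+ (p ^ (k - d)).
Let t d := r ^+ (p ^ (k - d)).

Definition theta d : algC := ratpoly_eval (theta_poly k d) a.

Let Aa : a \in Aint := Aint_root (pX_gt0 k) an.

Let YP d : (d <= k)%N -> Y d ^+ (p ^ d) = m%:~R.
Proof. by move=> ledk; rewrite -exprM -expnD subnK. Qed.

Let tP d : (d <= k)%N -> t d ^+ (p ^ d) = r ^+ n.
Proof. by move=> ledk; rewrite -exprM -expnD subnK. Qed.

Let nzc : c%:~R != 0 :> algC. Proof. by rewrite intr_eq0. Qed.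

Lemma eval_theta_poly l d x : ratpoly_eval (theta_poly l d) x = 
  (p ^ d)%:R^-1 * \sum_(i < p ^ d)
    (x ^+ (p ^ (l - d))) ^+ ((p ^ d).-1 - i) * (t d)%:~R ^+ i.
Proof.
rewrite ratpoly_evalZ fmorphV /= ratr_nat ratpoly_eval_int; congr (_ * _).
rewrite /intpoly_eval rmorph_sum horner_sum; apply: eq_bigr => i _.
rewrite /= map_polyZ hornerZ map_polyXn hornerXn -exprM mulrC.
by rewrite -[in RHS]rmorphXn -exprM.
Qed.

Lemma thetaE d : (d <= k)%N ->
  (p ^ d)%:R * (Y d - (t d)%:~R) * theta d = c%:~R.
Proof.
move=> ledk; rewrite /theta eval_theta_poly mulrAC mulrA mulfV // mul1r mulrC.
by rewrite -subrXX YP // -rmorphXn tP // -rmorphB.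
Qed.

Lemma eval_theta_pow l d : (d <= l <= k)%N ->
  ratpoly_eval (theta_poly l d) (Y l) = theta d.
Proof.
case/andP=> ledl lelk; rewrite /theta !eval_theta_poly.
suff -> : Y l ^+ (p ^ (l - d)) = a ^+ (p ^ (k - d)) by [].
by rewrite -exprM -expnD; congr (_ ^+ (_ ^ _)); lia.
Qed.

Lemma theta_neq0 d : (d <= k)%N -> (Y d - (t d)%:~R != 0) && (theta d != 0).
Proof.
move=> ledk; have := nzc; rewrite -(thetaE ledk) !mulf_eq0 !negb_or.
by case/andP=> /andP[_ ->] ->.
Qed.

Lemma theta_Aint d : (d <= D)%N -> theta d \in Aint.
Proof.
move=> ledD; have ledk := leq_trans ledD leDk.
apply: (cofactor_quotient_Aint (d := d) (t := t d) pr_p _ nz_c _ (thetaE ledk)).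
  by rewrite (dvdn_trans _ pDc) // dvdn_exp2l.
by rewrite subrK YP // -rmorphXn tP // -rmorphB.
Qed.

Lemma theta0 : theta 0 = 1.
Proof.
by rewrite /theta eval_theta_poly expn0 invr1 mul1r big_ord1 !expr0 mulr1.
Qed.

(** Compare [thetaE] at d and d + 1: Y_d - t_d is the difference of the p-th powers of Y_(d+1) and
    t_(d+1), hence divisible by Y_(d+1) - t_(d+1). *)
Lemma theta_step d : (d < k)%N ->
  p%:R * theta d.+1 =
  theta d * \sum_(i < p) Y d.+1 ^+ (p.-1 - i) * (t d.+1)%:~R ^+ i.
Proof.
move=> ltdk; have /andP[nzY _] := theta_neq0 ltdk.
have pE : (p ^ (k - d) = p ^ (k - d.+1) * p)%N by rewrite -expnSr; congr expn; lia.
have zE : Y d - (t d)%:~R = (Y d.+1 - (t d.+1)%:~R) *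
    \sum_(i < p) Y d.+1 ^+ (p.-1 - i) * (t d.+1)%:~R ^+ i.
  by rewrite -subrXX -rmorphXn /= -!exprM -pE.
apply: (mulIf nzY); apply: (mulIf (nz_pX d)).
transitivity (c%:~R : algC); first by rewrite -(thetaE ltdk) expnS natrM; ring.
by rewrite -(thetaE (ltnW ltdk)) zE; ring.
Qed.

(** * The lattice and its stability under multiplication by a *)

Definition in_lattice (x : algC) : Prop :=
  exists u : 'I_n -> int,
    x = \sum_(j < n) (u j)%:~R * ratpoly_eval (basis_poly j) a.

Lemma in_lattice0 : in_lattice 0.
Proof. by exists (fun=> 0); rewrite big1 // => j _; rewrite mul0r. Qed.

Lemma in_latticeD x y : in_lattice x -> in_lattice y -> in_lattice (x + y).
Proof.
move=> [u ->] [v ->]; exists (fun j => u j + v j); rewrite -big_split /=.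
by apply: eq_bigr => j _; rewrite rmorphD mulrDl.
Qed.

Lemma in_latticeZ (e : int) x : in_lattice x -> in_lattice (e%:~R * x).
Proof.
move=> [u ->]; exists (fun j => e * u j); rewrite mulr_sumr.
by apply: eq_bigr => j _; rewrite rmorphM mulrA.
Qed.

Lemma in_latticeB x y : in_lattice x -> in_lattice y -> in_lattice (x - y).
Proof.
by move=> Lx /(in_latticeZ (-1)); rewrite mulN1r; apply: in_latticeD.
Qed.

Lemma in_lattice_sum I (s : seq I) (P : pred I) (F : I -> algC) :
  (forall i, P i -> in_lattice (F i)) -> in_lattice (\sum_(i <- s | P i) F i).
Proof.
by move=> LF; apply: big_rec => [|i x Pi Lx]; [apply: in_lattice0|apply: in_latticeD; auto].
Qed.

Lemma in_lattice_coprime (e f : int) x : coprimez e f ->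
  in_lattice (e%:~R * x) -> in_lattice (f%:~R * x) -> in_lattice x.
Proof.
case/coprimezP => [[u v] /= Euv] Le Lf.
rewrite -[x]mul1r -[1]/(1%:~R) -Euv rmorphD !rmorphM mulrDl -!mulrA.
by apply: in_latticeD; apply: in_latticeZ.
Qed.

Lemma in_lattice_basis (j : 'I_n) : in_lattice (ratpoly_eval (basis_poly j) a).
Proof.
exists (fun i => (i == j)%:Z); rewrite (bigD1 j) //= eqxx mul1r.
by rewrite big1 ?addr0 // => i /negPf->; rewrite mul0r.
Qed.

(** The number of basis elements of the form a^i theta_d. *)
Let bound d := (p ^ (k - d) - (if d < D then p ^ (k - d.+1) else 0))%N.

Let bound_gt0 d : (d <= D)%N -> (0 < bound d)%N.
Proof.
move=> ledD; rewrite /bound; case: (ltnP d D) => [ltdD|_]; last by rewrite subn0.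
by rewrite subn_gt0 ltn_exp2l //; have := leq_trans ltdD leDk; lia.
Qed.

Lemma basis_evalE j : ratpoly_eval (basis_poly j) a =
  a ^+ (j - (p ^ k - p ^ (k - depth j))) * theta (depth j).
Proof. by rewrite ratpoly_evalM ratpoly_eval_Xn. Qed.

Lemma in_lattice_theta d i : (d <= D)%N -> (i < bound d)%N ->
  in_lattice (a ^+ i * theta d).
Proof.
move=> ledD lti.
have lePk : (p ^ (k - d) <= p ^ k)%N by rewrite leq_exp2l // leq_subr.
have ltjn : (p ^ k - p ^ (k - d) + i < n)%N.
  by move: lti; rewrite /bound /n; case: ifP; lia.
have := in_lattice_basis (Ordinal ltjn).
by rewrite basis_evalE /= (depth_eq ledD lti) addKn.
Qed.

(** With [depth_eq], the basis consists exactly of the a^i theta_d with d <= D and i < bound d. *)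
Lemma basis_index j : (j < n)%N ->
  (j - (p ^ k - p ^ (k - depth j)) < bound (depth j))%N.
Proof.
move=> ltj; have := depth_bound ltj; have := depth_le j.
have ledk := leq_trans (depth_le j) leDk.
have lePk : (p ^ (k - depth j) <= p ^ k)%N by rewrite leq_exp2l // leq_subr.
rewrite /bound; case: (ltnP (depth j) D) => [ltd _ lej|_ _]; last first.
  by move: ltj; rewrite /n; lia.
have Dd : depth j = (k - up_log p (p ^ k - j))%N.
  by move: ltd; rewrite /depth; lia.
have ltU : (p ^ (k - (depth j).+1) < p ^ k - j)%N.
  rewrite ltnNge; apply/negP => /(up_log_min p_gt1).
  by have := leq_trans ltd leDk; lia.
have : (p ^ (k - (depth j).+1) <= p ^ (k - depth j))%N by rewrite leq_exp2l //; lia.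
by move: lej ltU lePk ltj; rewrite /n; lia.
Qed.

(** Only i + 1 = bound d leaves the basis. For d = D, [thetaE] gives a^(p^(k-D)) theta_D = t_D
    theta_D + c / p^D. For d < D, [theta_step] writes the new element as p theta_(d+1) minus integer
    multiples of lower a^j theta_d. *)
Lemma in_lattice_mul_root x : in_lattice x -> in_lattice (a * x).
Proof.
case=> u ->; rewrite mulr_sumr; apply: in_lattice_sum => j _.
rewrite mulrCA; apply: in_latticeZ; rewrite basis_evalE mulrA -exprS.
have := basis_index (ltn_ord j); move: (depth_le j).
move: (j - _)%N => i; move: (depth j) => d ledD.
rewrite leq_eqVlt => /predU1P[Ei|]; last exact: in_lattice_theta.
have ledk := leq_trans ledD leDk.
have [ltdD|leDd] := ltnP d D; last first.
  have {}Ed : d = D by apply/eqP; rewrite eqn_leq ledD.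
  rewrite Ei /bound ltnNge leDd /= subn0 Ed.
  have [e De] : exists e : int, c = e * (p ^ D)%:Z.
    apply/dvdzP; rewrite dvdzE /=; apply: dvdn_trans pDc.
    by rewrite dvdn_exp2l.
  have zE : (Y D - (t D)%:~R) * theta D = e%:~R.
    apply: (mulfI (nz_pX D)); rewrite mulrA thetaE // De rmorphM /=.
    by rewrite -pmulrn mulrC.
  have -> : a ^+ (p ^ (k - D)) * theta D = (t D)%:~R * theta D + e%:~R * theta 0.
    by rewrite theta0 mulr1 -zE /Y; ring.
  apply: in_latticeD; apply: in_latticeZ.
    by rewrite -[theta _]mul1r -(expr0 a); apply: in_lattice_theta; rewrite ?bound_gt0.
  by rewrite -[theta _]mul1r -(expr0 a); apply: in_lattice_theta; rewrite ?bound_gt0.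
have ltdk := leq_trans ltdD leDk.
have pE : (p ^ (k - d) = p ^ (k - d.+1) * p)%N by rewrite -expnSr; congr expn; lia.
have Ei1 : i.+1 = (p ^ (k - d.+1) * p.-1)%N.
  by rewrite Ei /bound ltdD pE -subn1 mulnBr muln1.
have -> : a ^+ i.+1 * theta d = p%:Z%:~R * theta d.+1
  - \sum_(l < p | l != Ordinal p_gt0)
       ((t d.+1) ^+ l)%:~R * (a ^+ (p ^ (k - d.+1) * (p.-1 - l)) * theta d).
  rewrite -pmulrn theta_step // (bigD1 (Ordinal p_gt0)) //= subn0 expr0 mulr1.
  rewrite -exprM -Ei1 mulrDr mulr_sumr [theta d * _]mulrC -addrA.
  rewrite -[LHS]addr0; congr (_ + _); apply/esym/eqP; rewrite subr_eq0; apply/eqP.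
  by apply: eq_bigr => l _; rewrite /Y /t !rmorphXn /= exprM; ring.
apply: in_latticeB; first by apply: in_latticeZ; rewrite -[theta _]mul1r -(expr0 a);
  apply: in_lattice_theta; rewrite ?bound_gt0.
apply: in_lattice_sum => l nz_l; apply: in_latticeZ; apply: in_lattice_theta => //.
rewrite /bound ltdD pE -[X in (_ < _ - X)%N]muln1 -mulnBr ltn_mul2l pX_gt0 /=.
have : (val l != 0)%N by apply: contra nz_l => /eqP l0; apply/eqP/val_inj.
by have := ltn_ord l => /=; lia.
Qed.

Lemma in_lattice_intpoly (w : {poly int}) x :
  in_lattice x -> in_lattice (intpoly_eval w a * x).
Proof.
move=> Lx; rewrite /intpoly_eval horner_coef mulr_suml.
apply: in_lattice_sum => i _; rewrite coef_map -mulrA; apply: in_latticeZ.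
elim: {i}(nat_of_ord i) => [|i IHi]; first by rewrite mul1r.
by rewrite exprS -mulrA; apply: in_lattice_mul_root.
Qed.

Lemma in_lattice_theta0 d : (d <= D)%N -> in_lattice (theta d).
Proof.
move=> ledD; rewrite -[theta _]mul1r -(expr0 a).
by apply: in_lattice_theta; rewrite ?bound_gt0.
Qed.

Lemma in_lattice_Zroot (w : {poly int}) : in_lattice (intpoly_eval w a).
Proof.
by rewrite -[intpoly_eval _ _]mulr1 -theta0; apply/in_lattice_intpoly/in_lattice_theta0.
Qed.

Lemma in_lattice_clear x : in_lattice x ->
  exists2 w : {poly int}, (size w <= n)%N & (p ^ D)%:R * x = intpoly_eval w a.
Proof.
pose w j := (p ^ (D - depth j))%:Z *:
  ('X^(j - (p ^ k - p ^ (k - depth j))) * cofactor_poly k (depth j)).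
have wE j : intpoly_eval (w j) a = (p ^ D)%:R * ratpoly_eval (basis_poly j) a.
  rewrite -ratpoly_eval_int.
  have -> : map_poly intr (w j) = (p ^ D)%:R *: basis_poly j.
    rewrite /w /basis_poly /theta_poly linearZ /= rmorphM /= map_polyXn.
    rewrite -scalerAr scalerA; congr (_ *: _).
    rewrite -[in RHS](subnK (depth_le j)) expnD natrM mulfK //.
    by rewrite pnatr_eq0 -lt0n.
  by rewrite ratpoly_evalZ ratr_nat.
case=> u ->; exists (\sum_(j < n) u j *: w j).
  rewrite (leq_trans (size_sum _ _ _)) //; apply/bigmax_leqP => j _.
  rewrite !(leq_trans (size_scale_leq _ _)) //.
  rewrite (leq_trans (size_polyMleq _ _)) // size_polyXn /= .
  have ledk := leq_trans (depth_le j) leDk.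
  have lePk : (p ^ (k - depth j) <= p ^ k)%N by rewrite leq_exp2l // leq_subr.
  have arith i q n' s : (i < q)%N -> (s <= (n' - q).+1)%N -> (q <= n')%N ->
    (i + s <= n')%N by lia.
  apply: arith (size_cofactor_poly ledk) lePk.
  by apply: leq_trans (basis_index (ltn_ord j)) _; rewrite leq_subr.
rewrite intpoly_eval_sum mulr_sumr; apply: eq_bigr => j _.
by rewrite intpoly_evalZ mulrCA -wE.
Qed.

Lemma in_lattice_Aint x : in_lattice x -> x \in Aint.
Proof.
case=> u ->; rewrite rpred_sum // => j _; rewrite rpredM ?rpred_int //.
by rewrite basis_evalE rpredM ?rpredX ?theta_Aint ?depth_le.
Qed.

Lemma in_lattice_exp i x : in_lattice x -> in_lattice (a ^+ i * x).
Proof.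
move=> Lx; elim: i => [|i IHi]; first by rewrite mul1r.
by rewrite exprS -mulrA; apply: in_lattice_mul_root.
Qed.

(** * The lattice modulo pi *)

Let pi : algC := a - r%:~R.

Let Api : pi \in Aint. Proof. by rewrite rpredB ?rpred_int. Qed.

Lemma in_lattice_pi x : in_lattice x -> in_lattice (pi * x).
Proof.
move=> Lx; rewrite mulrBl; apply: in_latticeB; last exact: in_latticeZ.
exact: in_lattice_mul_root.
Qed.

(** Modulo pi L, with L the lattice, a^i acts as the integer r^i. *)
Let subX_pi i x : in_lattice x ->
  exists2 w, in_lattice w & (a ^+ i - (r ^+ i)%:~R) * x = pi * w.
Proof.
move=> Lx; rewrite rmorphXn /= subrXX -mulrA.
exists ((\sum_(j < i) a ^+ (i.-1 - j) * r%:~R ^+ j) * x); last by [].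
rewrite mulr_suml; apply: in_lattice_sum => j _.
by rewrite -mulrA -rmorphXn; apply/in_lattice_exp/in_latticeZ.
Qed.

Lemma nz_pi : pi != 0.
Proof.
by have /andP[] := theta_neq0 (leqnn k); rewrite /Y /t subnn !expr1.
Qed.

Lemma in_lattice_decomp x : in_lattice x ->
  exists e : nat -> int, exists2 w, in_lattice w &
    x = \sum_(d < D.+1) (e d)%:~R * theta d + pi * w.
Proof.
case=> u ->; elim/big_rec: _ => [|j y _ [e [w Lw ->]]].
  exists (fun=> 0), 0; first exact: in_lattice0.
  by rewrite mulr0 addr0 big1 // => d _; rewrite mul0r.
rewrite basis_evalE; move: (j - _)%N (depth_le j) => i; move: (depth j) => d ledD.
have [w' Lw' Ew'] := subX_pi i (in_lattice_theta0 ledD).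
exists (fun l => e l + (if l == d then u j * r ^+ i else 0)), (w + (u j)%:~R * w').
  by apply: in_latticeD => //; apply: in_latticeZ.
have -> : a ^+ i * theta d = (r ^+ i)%:~R * theta d + pi * w' by rewrite -Ew'; ring.
under [in RHS]eq_bigr => l _ do rewrite rmorphD mulrDl.
rewrite big_split /= [X in _ = _ + X + _](bigD1 (Ordinal (ledD : (d < D.+1)%N))) //=.
rewrite eqxx [X in _ = _ + (_ + X) + _]big1 => [|l neq_ld]; first by rewrite rmorphM /=; ring.
rewrite (_ : (val l == d) = false) ?mul0r //; apply: contraNF neq_ld => /eqP ld.
exact/eqP/val_inj.
Qed.

(** Induction by [theta_step]: modulo pi L its sum acts as the integer p t_(d+1)^(p-1), so p
    theta_(d+1) is congruent to t_(d+1)^(p-1) times p theta_d. *)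
Lemma pmul_theta d : (d <= D)%N ->
  exists e : int, exists2 w, in_lattice w & p%:R * theta d = e%:~R * p%:R + pi * w.
Proof.
elim: d => [_|d IHd ltdD].
  by exists 1, 0; [exact: in_lattice0 | rewrite theta0; ring].
have ltdk := leq_trans ltdD leDk.
have [e [w Lw Ew]] := IHd (ltnW ltdD).
pose s := (p ^ (k - d.+1))%N.
have Ld := in_lattice_theta0 (ltnW ltdD).
have Lsum : exists2 w', in_lattice w' &
    theta d * \sum_(i < p) Y d.+1 ^+ (p.-1 - i) * (t d.+1)%:~R ^+ i =
    theta d * \sum_(i < p) ((t d.+1) ^+ p.-1)%:~R + pi * w'.
  rewrite !mulr_sumr; apply: (big_rec2 (fun x y =>
    exists2 w', in_lattice w' & x = y + pi * w')).
    by exists 0; [exact: in_lattice0 | rewrite mulr0 addr0].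
  move=> i x y _ [w' Lw' ->].
  have [v Lv Ev] := subX_pi (s * (p.-1 - i)) Ld.
  exists (w' + ((t d.+1) ^+ i)%:~R * v).
    by apply: in_latticeD => //; apply: in_latticeZ.
  have tE : ((t d.+1) ^+ p.-1)%:~R =
      ((t d.+1) ^+ i)%:~R * (r ^+ (s * (p.-1 - i)))%:~R :> algC.
    rewrite -rmorphM /= exprM -exprD; congr (_ ^+ _)%:~R.
    by have := ltn_ord i; lia.
  have YE : Y d.+1 ^+ (p.-1 - i) = a ^+ (s * (p.-1 - i)) by rewrite exprM.
  rewrite mulrDr [pi * (_ * v)]mulrCA -Ev tE YE -rmorphXn /=.
  by ring.
have [w' Lw' Ew'] := Lsum; rewrite theta_step // Ew' sumr_const card_ord.
exists (t d.+1 ^+ p.-1 * e), (((t d.+1) ^+ p.-1)%:~R * w + w').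
  by apply: in_latticeD => //; apply: in_latticeZ.
by rewrite -[_ *+ p]mulr_natl [theta d * _]mulrA [theta d * _]mulrC Ew rmorphM /=; ring.
Qed.

(** * Independence, and saturation at l != p and at p dividing m *)

Variable q : nat.
Hypotheses (pr_q : prime q) (qm : (q %| `|m|)%N).
Hypothesis sqf_m : forall l : nat, prime l -> ~~ (l * l %| `|m|)%N.

Lemma lattice_basis_free (u : 'I_n -> int) :
  \sum_(j < n) (u j)%:~R * ratpoly_eval (basis_poly j) a = 0 -> forall j, u j = 0.
Proof.
move=> u0; pose g := \sum_(j < n) (u j)%:~R *: basis_poly j.
have szb (j : 'I_n) : size (basis_poly j) = j.+1 by apply: size_basis_poly.
have g0 : g = 0.
  apply: (ratpoly_eval_inj0 (pX_gt0 k) pr_q qm (sqf_m pr_q) an).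
    rewrite (leq_trans (size_sum _ _ _)) //; apply/bigmax_leqP => j _.
    by rewrite (leq_trans (size_scale_leq _ _)) // szb.
  rewrite ratpoly_eval_sum -[RHS]u0; apply: eq_bigr => j _.
  by rewrite ratpoly_evalZ ratr_int.
(* Descending induction on the degree: once the higher u_i vanish, the coefficient of X^j in [g]
   comes from [basis_poly j] alone, whose degree is [j]. *)
suff main l : forall j : 'I_n, (n - l <= j)%N -> u j = 0.
  by move=> j; apply: (main n); rewrite subnn.
elim: l => [|l IHl] j lej; first by have := ltn_ord j; lia.
have [lej'|ltj] := leqP (n - l) j; first exact: IHl.
have := congr1 (fun h : {poly rat} => h`_j) g0; rewrite coef0 coef_sum (bigD1 j) //=.
rewrite big1 ?addr0 => [|i neq_ij].
  rewrite coefZ => /eqP; rewrite mulf_eq0 intr_eq0 => /orP[/eqP //|].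
  have <- : lead_coef (basis_poly j) = (basis_poly j)`_j by rewrite lead_coefE szb.
  by rewrite lead_coef_eq0 -size_poly_eq0 szb.
rewrite coefZ; have [lij|ltji|/val_inj Eij] := ltngtP i j; last by rewrite Eij eqxx in neq_ij.
  by rewrite nth_default ?mulr0 // szb.
by rewrite IHl ?mul0r //; lia.
Qed.

Lemma in_lattice_of_dvd (l : nat) (w : {poly int}) (y : algC) : prime l ->
  (forall i : nat, (l %| `|(w`_i)%R|)%N) -> l%:R * y = intpoly_eval w a ->
  in_lattice y.
Proof.
move=> pr_l dvd_w Ey; have nz_l : l%:R != 0 :> algC by rewrite pnatr_eq0 -lt0n prime_gt0.
suff -> : y = intpoly_eval (map_poly (fun e => (e %/ l)%Z) w) a by apply: in_lattice_Zroot.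
apply: (mulfI nz_l); rewrite Ey.
have {1}-> : w = l%:Z *: map_poly (fun e => (e %/ l)%Z) w.
  apply/polyP => i; rewrite coefZ coef_map_id0 ?div0z // mulrC divzK //.
  by rewrite dvdzE.
by rewrite intpoly_evalZ -pmulrn.
Qed.

(** Multiplying by p^D moves l x into Z[a], where [coef_dvd_of_Aint] divides by [l]; the factor p^D
    is then removed because it is prime to [l]. *)
Lemma in_lattice_saturated_other (l : nat) (x : algC) :
  prime l -> l != p -> x \in Aint -> in_lattice (l%:R * x) -> in_lattice x.
Proof.
move=> pr_l neq_lp Ax Lx; have [w szw Ew] := in_lattice_clear Lx.
have Ly : in_lattice ((p ^ D)%:R * x).
  have Ew' : l%:R * ((p ^ D)%:R * x) = intpoly_eval w a by rewrite -Ew mulrCA.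
  apply: (in_lattice_of_dvd pr_l _ Ew') => i.
  apply: (coef_dvd_of_Aint (pX_gt0 k) pr_q qm (sqf_m pr_q) an i pr_l _ _ szw _ Ew') => //.
  - exact: sqf_m.
  - by rewrite Euclid_dvdX // dvdn_prime2 // (negPf neq_lp).
  by rewrite rpredM ?rpred_nat.
apply: (in_lattice_coprime (e := l) (f := (p ^ D)%N)); rewrite -?pmulrn //.
by rewrite coprimezE /= coprimeXr // prime_coprime // dvdn_prime2.
Qed.

Lemma in_lattice_saturated_ramified (x : algC) :
  (p %| `|m|)%N -> D = 0%N -> x \in Aint -> in_lattice (p%:R * x) -> in_lattice x.
Proof.
move=> pm D0 Ax Lx; have [w szw] := in_lattice_clear Lx.
rewrite D0 expn0 mul1r => Ew; apply: (in_lattice_of_dvd pr_p _ Ew) => i.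
apply: (eisenstein_coef_dvd (pX_gt0 k) pr_p pm (sqf_m pr_p) an _ szw).
by rewrite -Ew congA_pmul.
Qed.

(** * Saturation at p when p does not divide m *)

Hypothesis pr : ~~ (p %| `|r|)%N.
Hypothesis pDc_max : (D < k)%N -> ~~ (p ^ D.+2 %| `|c|)%N.

(** The sum lies in Q(Y_d), of degree p^d, and theta_i has trace p^(d-i) times a power of [r].
    Modulo [p] only the term i = d survives, and [r] is a unit. *)
Lemma theta_nilpotent_top d (e : nat -> int) : (d <= D)%N ->
  congA p ((\sum_(i < d.+1) (e i)%:~R * theta i) ^+ n) 0 -> (p %| `|e d|)%N.
Proof.
move=> ledD nil; have ledk := leq_trans ledD leDk.
pose g : {poly rat} := \sum_(i < d.+1) (e i)%:~R *: theta_poly d i.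
pose s i := (p ^ (k - i) * (p ^ i).-1)%N.
have Eg : ratpoly_eval g (Y d) = \sum_(i < d.+1) (e i)%:~R * theta i.
  rewrite ratpoly_eval_sum; apply: eq_bigr => i _.
  by rewrite ratpoly_evalZ ratr_int eval_theta_pow // ledk -ltnS ltn_ord.
have szg : (size g <= p ^ d)%N.
  rewrite (leq_trans (size_sum _ _ _)) //; apply/bigmax_leqP => i _.
  have leid : (i <= d)%N by rewrite -ltnS.
  rewrite !(leq_trans (size_scale_leq _ _)) // (leq_trans (size_poly _ _)) //.
  by rewrite (leq_trans (size_cofactor_poly leid)) // ltn_subrL !pX_gt0.
have Ag : ratpoly_eval g (Y d) \in Aint.
  rewrite Eg rpred_sum // => i _; rewrite rpredM ?rpred_int // theta_Aint //.
  by apply: leq_trans ledD; rewrite -ltnS.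
have tr : (p ^ d)%:R * ratr g`_0 =
    (\sum_(i < d.+1) e i * ((p ^ (d - i))%:Z * r ^+ s i))%:~R :> algC.
  rewrite coef_sum !rmorph_sum mulr_sumr; apply: eq_bigr => i _.
  have leid : (i <= d)%N by rewrite -ltnS.
  rewrite !coefZ coef_map coef0_cofactor_poly /= !rmorphM fmorphV /= ratr_nat.
  have -> : (p ^ d)%:R = (p ^ (d - i))%:R * (p ^ i)%:R :> algC.
    by rewrite -natrM -expnD subnK.
  by rewrite !ratr_int -pmulrn [LHS]mulrCA -[X in _ * X = _]mulrA mulVKf.
rewrite -Eg in nil.
have := trace_dvd_of_nilpotent (pX_gt0 d) pr_q qm (sqf_m pr_q) (YP ledk) pr_p szg Ag nil tr.
rewrite big_ord_recr /= subnn expn0 mul1r.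
have dvd_low : (p %| \sum_(i < d) e i * ((p ^ (d - i))%:Z * r ^+ s i))%Z.
  apply: rpred_sum => i _; rewrite dvdz_mull // dvdz_mulr //.
  rewrite dvdzE /= -{1}[p]expn1 dvdn_exp2l // subn_gt0 //.
rewrite -[X in (X %| _)%N]/`|p%:Z|%N -dvdzE rpredDl // dvdzE /=.
by rewrite abszM abszX Euclid_dvdM // Euclid_dvdX // (negPf pr) andFb orbF.
Qed.

Lemma theta_nilpotent_dvd d (e : nat -> int) : (d <= D)%N ->
  congA p ((\sum_(i < d.+1) (e i)%:~R * theta i) ^+ n) 0 ->
  forall i, (i <= d)%N -> (p %| `|e i|)%N.
Proof.
elim: d => [|d IHd] ledD nil i; have ped := theta_nilpotent_top ledD nil.
  by rewrite leqn0 => /eqP->.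
rewrite leq_eqVlt => /predU1P[-> //|]; apply: IHd => {i}; first exact: ltnW.
have Asum l : (l <= D)%N -> \sum_(i < l.+1) (e i)%:~R * theta i \in Aint.
  move=> lelD; rewrite rpred_sum // => i _; rewrite rpredM ?rpred_int // theta_Aint //.
  by apply: leq_trans lelD; rewrite -ltnS.
apply: congA_trans nil; apply: congA_exp; rewrite ?Asum //; first exact: ltnW.
rewrite [in X in congA _ _ X]big_ord_recr /=; apply: congA_sym.
rewrite -[X in congA _ _ X]addr0 congA_add ?congA_refl //.
by rewrite mulrC congA_mul0 ?theta_Aint ?congA_dvd.
Qed.

(** By Frobenius, pi^n is congruent to a^n - r^n = c. *)
Lemma pi_expn_cong : congA p (pi ^+ n) 0.
Proof.
have pc : congA p c%:~R 0.
  by apply: congA_dvd => //; apply: dvdn_trans pDc; rewrite expnS dvdn_mulr.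
apply: congA_trans pc.
have -> : c%:~R = a ^+ n - r%:~R ^+ n :> algC by rewrite rmorphB rmorphXn /= an.
have := congA_frobenius_add pr_p k Api (rpred_int _ r).
rewrite {1}/pi subrK => /congA_sym/congA_add/(_ (congA_refl p (- r%:~R ^+ n))).
by rewrite -/n addrK.
Qed.

Lemma in_lattice_saturated_pi y : y \in Aint ->
  in_lattice (pi * y) -> in_lattice (p%:R * y) -> in_lattice y.
Proof.
move=> Ay Lpiy Lpy; have [e [w Lw Ew]] := in_lattice_decomp Lpiy.
have pe : forall d, (d <= D)%N -> (p %| `|e d|)%N.
  apply: theta_nilpotent_dvd => //.
  have -> : \sum_(d < D.+1) (e d)%:~R * theta d = pi * (y - w).
    by rewrite mulrBr Ew addrK.
  rewrite exprMn mulrC congA_mul0 ?pi_expn_cong ?rpredX ?rpredB //.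
  exact: in_lattice_Aint.
(* As [p] divides every e_d, [pmul_theta] turns each e_d theta_d into an integer multiple of [p]
   modulo pi L. *)
have [f [v Lv Ev]] : exists f : int, exists2 v, in_lattice v &
    \sum_(d < D.+1) (e d)%:~R * theta d = f%:~R * p%:R + pi * v.
  apply: (big_rec (fun x => exists f : int, exists2 v, in_lattice v &
    x = f%:~R * p%:R + pi * v)).
    by exists 0, 0; [exact: in_lattice0 | ring].
  move=> d x _ [f [v Lv ->]]; have ledD : (d <= D)%N by rewrite -ltnS.
  have /dvdzP[l El] : (p %| e d)%Z by rewrite dvdzE pe.
  have [f' [v' Lv' Ev']] := pmul_theta ledD.
  exists (l * f' + f), (l%:~R * v' + v).
    by apply: in_latticeD => //; apply: in_latticeZ.
  rewrite El rmorphM /= -pmulrn -[_ * _ * theta d]mulrA Ev' rmorphD rmorphM /=.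
  by ring.
have Lwv := in_latticeD Lw Lv.
suff : in_lattice (y - (w + v)) by move=> /in_latticeD/(_ Lwv); rewrite subrK.
have piz : pi * (y - (w + v)) = f%:~R * p%:R by rewrite mulrBr Ew Ev; ring.
have Az : y - (w + v) \in Aint by rewrite rpredB // in_lattice_Aint.
have Lpz : in_lattice (p%:R * (y - (w + v))).
  by rewrite mulrBr; apply: in_latticeB => //; rewrite pmulrn; apply: in_latticeZ.
move: (y - (w + v)) piz Az Lpz => z piz Az Lpz.
have [c' Dc'] : exists c', c = c' * (p ^ D.+1)%:Z by apply/dvdzP; rewrite dvdzE.
have [v' Lv' Ev'] := subX_pi (p ^ (k - D)) (in_lattice_theta0 (leqnn D)).
(* Here c' = c / p^(D+1) and pi v' = (Y_D - t_D) theta_D; combining pi z = f p with [thetaE] cancels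
   pi and p^D. *)
have c'z : c'%:~R * z = f%:~R * v'.
  apply: (mulfI nz_pi); apply: (mulIf (nz_pX D)).
  have -> : pi * (c'%:~R * z) * (p ^ D)%:R = f%:~R * c%:~R.
    by rewrite Dc' rmorphM /= -pmulrn expnS natrM [pi * _]mulrCA piz; ring.
  by rewrite -(thetaE leDk) /Y /t [pi * _]mulrCA -Ev'; ring.
(* If D < k, maximality of D makes c' prime to [p], so c' z and p z in the lattice suffice. *)
have [ltDk|leDk'] := ltnP D k.
  apply: (in_lattice_coprime (e := c') (f := p)); rewrite -?pmulrn //; last first.
    by rewrite c'z; apply: in_latticeZ.
  rewrite coprimezE coprime_sym prime_coprime //=.
  apply: contra (pDc_max ltDk) => pc'.
  by rewrite Dc' abszM expnS dvdn_mul.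
(* If D = k, then c' may be divisible by [p], but Y_D - t_D = pi and z = (f / c') theta_D. The trace
   of z is f r^M / c', an integer b, so r^M z = b theta_D with r^M prime to [p]. *)
have Dk : D = k by apply/eqP; rewrite eqn_leq leDk.
have Ev1 : v' = theta D.
  by apply: (mulfI nz_pi); rewrite -Ev' Dk subnn expr1.
have nz_c' : c'%:~R != 0 :> algC.
  by rewrite intr_eq0; apply: contra nz_c => /eqP c'0; rewrite Dc' c'0 mul0r.
pose M := (p ^ (k - D) * (p ^ D).-1)%N.
pose g : {poly rat} := (f%:~R / c'%:~R) *: theta_poly k D.
have szg : (size g <= n)%N.
  rewrite !(leq_trans (size_scale_leq _ _)) // (leq_trans (size_poly _ _)) //.
  by rewrite (leq_trans (size_cofactor_poly leDk)) // ltn_subrL !pX_gt0.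
have Eg : ratpoly_eval g a = z.
  rewrite ratpoly_evalZ fmorph_div /= !ratr_int -/(theta D).
  by apply: (mulfI nz_c'); rewrite c'z Ev1; field.
have := coef_Aint (pX_gt0 k) pr_q qm (sqf_m pr_q) an (Ordinal (pX_gt0 k)) szg.
rewrite Eg => /(_ Az) /=.
have -> : (p ^ k)%:R * (ratr g`_0 * a ^+ 0) = (f * r ^+ M)%:~R / c'%:~R.
  rewrite !coefZ coef_map coef0_cofactor_poly /= !rmorphM !fmorphV /= ratr_nat.
  have -> : (p ^ k)%:R = (p ^ D)%:R :> algC by rewrite Dk.
  rewrite !ratr_int -/M; move: (p ^ D)%:R (nz_pX D) => P nzP; field.
  by rewrite nzP nz_c'.
move=> Ab; have /intrP[b Eb] : ((f * r ^+ M)%:~R / c'%:~R : algC) \in Num.int.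
  by apply: Cint_rat_Aint => //; rewrite rpred_div ?rpred_int.
apply: (in_lattice_coprime (e := r ^+ M) (f := p)); rewrite -?pmulrn //.
  by rewrite coprimezE abszX coprimeXl // coprime_sym prime_coprime.
suff -> : (r ^+ M)%:~R * z = b%:~R * theta D by apply/in_latticeZ/in_lattice_theta0.
apply: (mulfI nz_c'); rewrite mulrCA c'z Ev1 -Eb rmorphM /=; field.
exact: nz_c'.
Qed.

Lemma in_lattice_saturated_unramified x : x \in Aint ->
  in_lattice (p%:R * x) -> in_lattice x.
Proof.
move=> Ax Lpx.
have Lpi i : in_lattice (p%:R * (pi ^+ i * x)).
  elim: i => [|i IHi]; first by rewrite mul1r.
  by rewrite exprS -mulrA mulrCA; apply: in_lattice_pi.
have Lpin : in_lattice (pi ^+ n * x).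
  have Ebin : m%:~R = (pi + r%:~R) ^+ n by rewrite subrK.
  (* Expanding m = (pi + r)^n writes pi^n as c minus the middle binomial terms, and [p] divides c
     and all those binomial coefficients. *)
  have -> : pi ^+ n * x = (m - r ^+ n)%:~R * x
      - \sum_(i < n | i != Ordinal (pX_gt0 k))
          pi ^+ (n - i) * r%:~R ^+ i *+ 'C(n, i) * x.
    rewrite rmorphB rmorphXn /= Ebin [(pi + _) ^+ n]exprDn big_ord_recr /= subnn binn mulr1n.
    rewrite expr0 mul1r addrK (bigD1 (Ordinal (pX_gt0 k))) //= subn0 bin0.
    by rewrite expr0 mulr1 mulr1n mulrDl mulr_suml addrK.
  apply: in_latticeB.
    have [c' Dc'] : exists c', c = c' * (p ^ D.+1)%:Z.
      by apply/dvdzP; rewrite dvdzE.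
    rewrite -/c Dc' expnS PoszM mulrA mulrAC rmorphM /= -mulrA -pmulrn.
    exact: in_latticeZ.
  apply: in_lattice_sum => i nz_i; have : (p %| 'C(n, i))%N.
    apply: prime_dvd_bin_expn => //; rewrite ltn_ord andbT lt0n.
    by apply: contra nz_i => /eqP i0; apply/eqP/val_inj.
  case/dvdnP=> l ->.
  have -> : pi ^+ (n - i) * r%:~R ^+ i *+ (l * p) * x =
     (r ^+ i * l%:Z)%:~R * (p%:R * (pi ^+ (n - i) * x)).
    by rewrite rmorphM rmorphXn /= -pmulrn -mulr_natl natrM; ring.
  exact: in_latticeZ.
suff chain j : in_lattice (pi ^+ j * x) -> in_lattice x by exact: chain Lpin.
elim: j => [|j IHj Lj]; first by rewrite mul1r.
apply: IHj; apply: in_lattice_saturated_pi => //; first by rewrite rpredM ?rpredX.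
by rewrite mulrA -exprS.
Qed.

End PeriodicBasis.

(** * Choice of D from r, and saturation at all primes *)

Lemma dvd_expn_subr (p k : nat) (r : int) :
  prime p -> (p %| `|r ^+ (p ^ k) - r|)%N.
Proof.
move=> pr_p; rewrite -(dvdzE p%:Z) (dvdz_pcharf (pchar_Fp pr_p)) rmorphB rmorphXn /=.
rewrite subr_eq0; apply/eqP; elim: k => [|k IHk]; first by rewrite expr1.
by rewrite expnSr exprM IHk; have := expf_card (r%:~R : 'F_p); rewrite card_Fp.
Qed.

Theorem theorem3p9 (k p : nat) :
  (0 < k)%N -> prime p ->
  forall r : int,
  exists h : 'I_(p ^ k) -> {poly rat},
    forall m : int,
      squarefree_int m -> m != 1 -> m != -1 ->
      (m = r %[mod (p ^ k.+1)%:Z])%Z ->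
      forall a : algC, a ^+ (p ^ k) = m%:~R ->
        integral_basis a (fun i => ratpoly_eval (h i) a).
Proof.
move=> k_gt0 pr_p r; have p_gt1 := prime_gt1 pr_p.
have n_gt1 : (1 < p ^ k)%N by rewrite -(expn0 p) ltn_exp2l.
(* D must depend on [r] only. As m = r modulo p^(k+1), for d <= k the power p^(d+1) divides m - r^n
   exactly when it divides r^n - r. *)
pose P d := (d <= k)%N && (p ^ d.+1 %| `|r ^+ (p ^ k) - r|)%N.
have P0 : exists d, P d.
  exists 0%N; rewrite /P leq0n expn1 /=; exact: dvd_expn_subr.
have ubP d : P d -> (d <= k)%N by case/andP.
case: (ex_maxnP P0 ubP) => D /andP[leDk pDr] maxD.
exists (fun i => basis_poly p k D r i) => m sqf m1 mN1 mr a an.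
have sqf_m l : prime l -> ~~ (l * l %| `|m|)%N.
  by move=> pr_l; apply/negP => /sqf l1; rewrite l1 in pr_l.
have m_abs1 : `|m|%N != 1%N.
  by apply: contraTN isT => /eqP; move: m1 mN1; lia.
have m_gt0 : (0 < `|m|)%N.
  by rewrite lt0n; apply/negP => /eqP m0; have := sqf 0%N; rewrite m0 => /(_ isT).
(* Any prime factor of [m] serves as the Eisenstein prime for X^n - m. *)
pose q := pdiv `|m|.
have pr_q : prime q by rewrite pdiv_prime //; move: m_abs1 m_gt0; lia.
have qm : (q %| `|m|)%N := pdiv_dvd _.
have pk_mr : (p ^ k.+1 %| `|m - r|)%N.
  by move/eqP: mr; rewrite eqz_mod_dvd dvdzE.
have dvd_c d : (d <= k)%N ->
    (p ^ d.+1 %| `|m - r ^+ (p ^ k)|)%N = (p ^ d.+1 %| `|r ^+ (p ^ k) - r|)%N.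
  move=> ledk; rewrite -!(dvdzE (p ^ d.+1)%:Z).
  have -> : m - r ^+ (p ^ k) = (m - r) - (r ^+ (p ^ k) - r) by ring.
  rewrite rpredBl // dvdzE; apply: dvdn_trans pk_mr.
  by rewrite dvdn_exp2l.
(* If m = r^n with n >= 2, then r^2 divides [m], which forces |r| = 1 and |m| = 1. *)
have nz_c : m - r ^+ (p ^ k) != 0.
  rewrite subr_eq0; apply/negP => /eqP mE.
  have : (`|r| * `|r| %| `|m|)%N.
    by rewrite mE abszX -(subnK n_gt1) expnD dvdn_mull.
  move/sqf => r1; move: m_abs1; rewrite mE abszX r1 exp1n; lia.
have pDc : (p ^ D.+1 %| `|m - r ^+ (p ^ k)|)%N by rewrite dvd_c.
have pDc_max : (D < k)%N -> ~~ (p ^ D.+2 %| `|m - r ^+ (p ^ k)|)%N.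
  move=> ltDk; rewrite dvd_c //; apply/negP => dv.
  by have := maxD D.+1; rewrite /P ltDk dv ltnn => /(_ isT).
have p_mr : (p %| `|m|)%N = (p %| `|r|)%N.
  rewrite -!(dvdzE p%:Z) -[m](subrK r) rpredDl // dvdzE.
  by apply: dvdn_trans pk_mr; rewrite expnS dvdn_mulr.
(* If D > 0, then p^2 divides both m - r^n and r^n, hence [m]. *)
have D0 : (p %| `|m|)%N -> D = 0%N.
  rewrite p_mr => pr; apply/eqP; rewrite -leqn0 leqNgt; apply/negP => D_gt0.
  have p2 : (p ^ 2 %| p ^ D.+1)%N by rewrite dvdn_exp2l.
  have /negP[] := sqf_m p pr_p; rewrite -/(p ^ 2)%N -(dvdzE (p ^ 2)%:Z).
  have -> : m = (m - r ^+ (p ^ k)) + r ^+ (p ^ k) by ring.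
  rewrite rpredDl; first by rewrite dvdzE abszX -(subnK n_gt1) expnD dvdn_mull // dvdn_exp2r.
  exact: dvdn_trans p2 pDc.
have Lprime l x : prime l -> x \in Aint -> in_lattice p k D r a (l%:R * x) ->
    in_lattice p k D r a x.
  move=> pr_l Ax; have [->|neq_lp] := eqVneq l p; last first.
    exact: (in_lattice_saturated_other pr_p leDk nz_c an pDc pr_q qm sqf_m pr_l neq_lp).
  have [pm|pm] := boolP (p %| `|m|)%N.
    exact: (in_lattice_saturated_ramified pr_p leDk nz_c an pDc sqf_m pm (D0 pm)).
  rewrite p_mr in pm.
  exact: (in_lattice_saturated_unramified pr_p leDk nz_c an pDc pr_q qm sqf_m pm pDc_max).
have Lmul N x : (0 < N)%N -> x \in Aint -> in_lattice p k D r a (N%:R * x) ->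
    in_lattice p k D r a x.
  elim/ltn_ind: N => N IHN N_gt0 Ax LN.
  have [N_le1|N_gt1] := leqP N 1.
    have N1 : N = 1%N by apply/eqP; rewrite eqn_leq N_le1.
    by rewrite N1 mul1r in LN.
  have [pr_l dvl] := (pdiv_prime N_gt1, pdiv_dvd N).
  have NE : N = (pdiv N * (N %/ pdiv N))%N by rewrite mulnC divnK.
  have N'_gt0 : (0 < N %/ pdiv N)%N by rewrite divn_gt0 ?pdiv_gt0 // dvdn_leq.
  apply: (IHN (N %/ pdiv N)%N) => //; first by rewrite ltn_Pdiv // prime_gt1.
  apply: (Lprime (pdiv N)) => //; first by rewrite rpredM ?rpred_nat.
  by rewrite mulrA -natrM -NE.
split=> [i|x [g Eg] Ax|u u0 i].
- split; first by exists (basis_poly p k D r i).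
  apply: (in_lattice_Aint pr_p leDk nz_c an pDc).
  exact: in_lattice_basis.
(* A common denominator [d] of [g] brings d x into Z[a], hence into the lattice; [Lmul] then divides
   by |d|. *)
- have [w [d nz_d Dg]] := rat_poly_scale g.
  have := Lmul `|d|%N x; apply; rewrite ?absz_gt0 //.
  have Ew : d%:~R * x = intpoly_eval w a.
    rewrite Eg Dg ratpoly_evalZ fmorphV /= ratr_int mulVKf ?intr_eq0 //.
    exact: ratpoly_eval_int.
  rewrite pmulrn abszEsg rmorphM /= -mulrA; apply: in_latticeZ; rewrite Ew.
  exact: (in_lattice_Zroot pr_p leDk nz_c an pDc).
exact: (lattice_basis_free pr_p leDk nz_c an pDc pr_q qm sqf_m u0 i).
Qed.
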